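(* Let $\mathbb{X}$ be a real Banach space and let $\mathbb{Y}$ be a proper linear subspace of $\mathbb{X}$ with $\dim \mathbb{Y} > 1$. Suppose that for each $x \in \mathbb{X} \setminus \mathbb{Y}$ there exists a nonzero $y \in \mathbb{Y}$ such that $J(y) \subseteq J(x) \cup J(-x)$. Then $\mathbb{Y}$ is a strongly anti-coproximinal subspace of $\mathbb{X}$.
   Context: For nonzero $x \in \mathbb{X}$, $J(x) = \{f \in S_{\mathbb{X}^*} : f(x) = \|x\|\}$, where $S_{\mathbb{X}^*}$ is the unit sphere of the dual. For $\epsilon \in [0,1)$ and $x, y \in \mathbb{X}$, $x \perp_B^{\epsilon} y$ means $\|x + \lambda y\|^2 \ge \|x\|^2 - 2\epsilon \|x\| \|\lambda y\|$ for all $\lambda \in \mathbb{R}$ (it is known that this is equivalent to $\|x+\lambda y\| \ge \|x\| - \epsilon\|\lambda y\|$ for all $\lambda \in \mathbb{R}$). An element $y_0 \in \mathbb{Y}$ is an $\epsilon$-best coapproximation to $x$ out of $\mathbb{Y}$ if $y \perp_B^{\epsilon} (x - y_0)$ for all $y \in \mathbb{Y}$. $\mathbb{Y}$ is a strongly anti-coproximinal subspace of $\mathbb{X}$ if for every $x \in \mathbb{X} \setminus \mathbb{Y}$ and every $\epsilon \in [0,1)$ there does not exist any $\epsilon$-best coapproximation to $x$ out of $\mathbb{Y}$. *)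

(* Defs.v *)
From mathcomp Require Import all_boot all_order all_algebra.
From mathcomp Require Import all_classical all_reals all_analysis.

Set Implicit Arguments.
Unset Strict Implicit.
Unset Printing Implicit Defensive.

Import Order.TTheory GRing.Theory Num.Theory.
Import numFieldNormedType.Exports.

Local Open Scope classical_set_scope.
Local Open Scope ring_scope.

Definition dual_norm (R : realType) (X : normedModType R)
    (f : {linear X -> R^o}) : R :=
  sup [set `|f z| | z in [set z : X | `|z| <= 1]].

(* An element of the dual is a linear functional together with a continuity
   condition, and dual_norm is its operator norm only under that condition:
   sup is 0 on unbounded sets. *)
Definition dual_sphere (R : realType) (X : normedModType R) :
    set {linear X -> R^o} :=
  [set f : {linear X -> R^o} | continuous f /\ dual_norm f = 1].

(* Only meaningful for x != 0. *)
Definition J (R : realType) (X : normedModType R) (x : X) :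
    set {linear X -> R^o} :=
  [set f : {linear X -> R^o} | dual_sphere f /\ f x = `|x|].

Definition approx_BJ_orth (R : realType) (X : normedModType R)
    (eps : R) (x y : X) : Prop :=
  forall l : R,
    `|x| ^+ 2 - 2 * eps * `|x| * `|l *: y| <= `|x + l *: y| ^+ 2.

Definition best_coapprox (R : realType) (X : normedModType R)
    (eps : R) (Y : submodClosed X) (x y0 : X) : Prop :=
  y0 \in Y /\ forall y : X, y \in Y -> approx_BJ_orth eps y (x - y0).

Definition strongly_anti_coproximinal (R : realType) (X : normedModType R)
    (Y : submodClosed X) : Prop :=
  forall (x : X) (eps : R), x \notin Y -> 0 <= eps < 1 ->
    ~ exists y0 : X, best_coapprox eps Y x y0.

Definition linearly_independent (R : realType) (X : lmodType R) (n : nat)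
    (v : 'I_n -> X) : Prop :=
  forall c : 'I_n -> R, \sum_(i < n) c i *: v i = 0 -> forall i, c i = 0.

(* dim Y > n, with dim Y possibly infinite. *)
Definition dim_gt (R : realType) (X : lmodType R) (Y : submodClosed X)
    (n : nat) : Prop :=
  exists v : 'I_n.+1 -> X, (forall i, v i \in Y) /\ linearly_independent v.

(* Main.v *)
Require Import Defs.
From HB Require Import structures.
From mathcomp Require Import all_boot all_order all_algebra.
From mathcomp Require Import all_classical all_reals all_analysis.
From mathcomp Require Import lra.

Import Order.TTheory GRing.Theory Num.Theory.
Import numFieldNormedType.Exports.

Local Open Scope classical_set_scope.
Local Open Scope ring_scope.

Set Implicit Arguments.
Unset Strict Implicit.

(** If [y0] were an [eps]-best coapproximation to [x], put [z := x - y0] and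
    take a nonzero [y] in [Y] with [J y `<=` J z `|` J (- z)].  Since [y] is
    [eps]-orthogonal to [z], the sublinear functional
    [w |-> inf_b (`|w + b z| + eps |b| `|z|)] takes the value [`|y|] at [y], so
    Hahn-Banach gives [f] in [J y] below it, whence [`|f z| <= eps `|z|].  But
    [f] lies in [J z `|` J (- z)], so [`|f z| = `|z|], forcing [z = 0]. *)

(** * Sublinear functionals and cones of lower constraints *)

(* Asking only for [<=] in the homogeneity clause is enough: applying it to
   [t^-1], and subadditivity at [t = 0], gives equality. *)
Definition sublinear (R : realType) (V : lmodType R) (p : V -> R) : Prop :=
  (forall x y, p (x + y) <= p x + p y) /\
  (forall t x, 0 <= t -> p (t *: x) <= t * p x).

(** A pair [(v, r)] in [S] stands for a constraint [r <= f v] to be imposed on a linear [f] below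
    [p]. *)
Definition convex_cone_below (R : realType) (V : lmodType R) (p : V -> R)
    (S : set (V * R)) : Prop :=
  [/\ S (0, 0),
      forall v r w s, S (v, r) -> S (w, s) -> S (v + w, r + s),
      forall t v r, 0 <= t -> S (v, r) -> S (t *: v, t * r) &
      forall v r, S (v, r) -> r <= p v].

(** For linear [f], lying below this functional amounts to lying below [p] and meeting every
    constraint in [S]. *)
Definition cone_inf (R : realType) (V : lmodType R) (p : V -> R)
    (S : set (V * R)) (x : V) : R :=
  inf [set p (x + s.1) - s.2 | s in S].

Lemma sublinear_ge0N (R : realType) (V : lmodType R) (p : V -> R) (x : V) :
  sublinear p -> - p (- x) <= p x.
Proof.
move=> [pD pZ]; have := pD 0 0; have := pD x (- x); rewrite subrr addr0; lra.
Qed.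

(** The infimum is genuine: [r <= p v <= p (x + v) + p (- x)] bounds the set below by
    [- p (- x)]. *)
Lemma cone_inf_le (R : realType) (V : lmodType R) (p : V -> R)
    (S : set (V * R)) (x v : V) (r : R) :
  sublinear p -> convex_cone_below p S -> S (v, r) ->
  cone_inf p S x <= p (x + v) - r.
Proof.
move=> [pD _] [_ _ _ leS] Svr; apply: ge_inf; last by exists (v, r).
exists (- p (- x)) => _ [[w s] /leS/= sw <-].
by have := pD (x + w) (- x); rewrite addrAC subrr add0r; lra.
Qed.

Lemma le_cone_inf (R : realType) (V : lmodType R) (p : V -> R)
    (S : set (V * R)) (x : V) (c : R) :
  S !=set0 -> (forall v r, S (v, r) -> c <= p (x + v) - r) ->
  c <= cone_inf p S x.
Proof.
move=> [s Ss] cS; apply: lb_le_inf; first by exists (p (x + s.1) - s.2), s.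
by move=> _ [[v r] /cS cvr <-].
Qed.

Lemma cone_inf_sublinear (R : realType) (V : lmodType R) (p : V -> R)
    (S : set (V * R)) :
  sublinear p -> convex_cone_below p S -> sublinear (cone_inf p S).
Proof.
move=> slp coneS; have [pD pZ] := slp; have [S0 SD SZ _] := coneS.
have neS : S !=set0 by exists (0, 0).
split=> [x y | t x].
  rewrite -lerBlDr; apply: le_cone_inf => // v r Svr.
  rewrite lerBlDr -lerBlDl; apply: le_cone_inf => // w s Sws.
  have := cone_inf_le (x + y) slp coneS (SD _ _ _ _ Svr Sws).
  by rewrite addrACA; have := pD (x + v) (y + w); lra.
rewrite le_eqVlt => /predU1P[<-|t0].
  have := cone_inf_le 0 slp coneS S0; have := pZ 0 0 (lexx _).
  by rewrite !scale0r addr0; lra.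
rewrite -ler_pdivrMl//; apply: le_cone_inf => // v r Svr.
rewrite ler_pdivrMl//.
have := cone_inf_le (t *: x) slp coneS (SZ _ _ _ (ltW t0) Svr).
by rewrite -scalerDr; have := pZ t (x + v) (ltW t0); lra.
Qed.

(** * Hahn-Banach via minimal sublinear functionals *)

(** Zorn's lemma: the pointwise infimum of a nonempty chain is again sublinear. *)
Lemma exists_minimal_sublinear (R : realType) (V : lmodType R) (p : V -> R) :
  sublinear p ->
  exists q : V -> R, [/\ sublinear q, forall x, q x <= p x &
    forall q', sublinear q' -> (forall x, q' x <= q x) ->
      forall x, q x <= q' x].
Proof.
move=> slp; pose T := {q : V -> R | sublinear q /\ forall x, q x <= p x}.
(* The order is reversed, so that Zorn's maximal element is pointwise minimal. *)
pose le (s t : T) := `[< forall x, sval t x <= sval s x >].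
pose p0 : T := exist _ p (conj slp (fun=> lexx _)).
have [||A totA|[q [slq qp]] qmin] := @ZL_preorder T p0 le.
- by move=> s; apply/asboolP.
- by move=> r s t /asboolP rs /asboolP st; apply/asboolP => x;
    exact: le_trans (st x) (rs x).
- have [neA|A0] := pselect (A !=set0); last first.
    by exists p0 => s As; exfalso; apply: A0; exists s.
  pose m x := inf [set sval s x | s in A].
  have m_le s x : A s -> m x <= sval s x.
    move=> As; apply: ge_inf; last by exists s.
    exists (- p (- x)) => _ [[q [slq qp]] _ <-] /=.
    by have := sublinear_ge0N x slq; have := qp (- x); lra.
  have le_m x c : (forall s, A s -> c <= sval s x) -> c <= m x.
    move=> cA; have [s As] := neA.
    by apply: lb_le_inf; [exists (sval s x), s | move=> _ [u /cA cu <-]].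
  have slm : sublinear m.
    split=> [x y|t x t0].
      rewrite -lerBlDr; apply: (le_m) => s As.
      rewrite lerBlDr -lerBlDl; apply: le_m => u Au.
      (* Subadditivity needs one functional at both [x] and [y]; the chain condition lets the
         smaller of [s] and [u] serve. *)
      have [/asboolP su|/asboolP us] := totA _ _ As Au.
        have := m_le _ (x + y) Au; have := (svalP u).1.1 x y.
        by have := su x; lra.
      have := m_le _ (x + y) As; have := (svalP s).1.1 x y.
      by have := us y; lra.
    move: t0; rewrite le_eqVlt => /predU1P[<-|t0].
      have [s As] := neA; have := m_le _ (0 *: x) As.
      by have := (svalP s).1.2 0 x (lexx _); lra.
    rewrite -ler_pdivrMl//; apply: (le_m) => s As; rewrite ler_pdivrMl//.
    by have := m_le _ (t *: x) As; have := (svalP s).1.2 t x (ltW t0); lra.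
  have mp x : m x <= p x.
    by have [s As] := neA; exact: le_trans (m_le _ _ As) ((svalP s).2 x).
  by exists (exist _ m (conj slm mp)) => s As; apply/asboolP => x; exact: m_le.
exists q; split=> // q' slq' q'q x.
have q'p z : q' z <= p z by exact: le_trans (q'q z) (qp z).
have /asboolP := qmin (exist _ q' (conj slq' q'p)) (asboolT q'q).
exact.
Qed.

(* Minimality of [q] against [cone_inf q] of the ray through [(x, q x)] yields
   [q z + q x <= q (z + x)]. *)
Lemma minimal_sublinear_linear (R : realType) (V : lmodType R) (q : V -> R) :
  sublinear q ->
  (forall q', sublinear q' -> (forall x, q' x <= q x) ->
     forall x, q x <= q' x) ->
  linear (q : V -> R^o).
Proof.
move=> slq qmin; have [qD0 qZ] := slq.
have qD x z : q (x + z) = q x + q z.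
  pose S : set (V * R) := [set s | exists2 t, 0 <= t & s = (t *: x, t * q x)].
  have coneS : convex_cone_below q S.
    split.
    - by exists 0; rewrite // scale0r mul0r.
    - move=> _ _ _ _ [t t0 [-> ->]] [u u0 [-> ->]].
      by exists (t + u); rewrite ?addr_ge0// scalerDl mulrDl.
    - move=> t _ _ t0 [u u0 [-> ->]].
      by exists (t * u); rewrite ?mulr_ge0// scalerA mulrA.
    - move=> _ _ [t t0 [-> ->]].
      move: t0; rewrite le_eqVlt => /predU1P[<-|t0].
        by rewrite scale0r mul0r; have := qD0 0 0; rewrite addr0; lra.
      have := qZ t^-1 (t *: x); rewrite invr_ge0 ltW// scalerA mulVf ?gt_eqF//.
      by rewrite scale1r mulrC ler_pdivlMr// mulrC; exact.
  have [S0 _ _ _] := coneS.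
  have Sx : S (x, q x) by exists 1; rewrite ?scale1r ?mul1r.
  apply/le_anti; rewrite qD0/=.
  have := qmin _ (cone_inf_sublinear slq coneS) _ z.
  have leq w : cone_inf q S w <= q w.
    by have := cone_inf_le w slq coneS S0; rewrite addr0 subr0.
  by move=> /(_ leq); have := cone_inf_le z slq coneS Sx;
    rewrite (addrC z); lra.
have q0 : q 0 = 0 by have := qD 0 0; rewrite addr0; lra.
have qN x : q (- x) = - q x by have := qD x (- x); rewrite subrr q0; lra.
have qZ_ge0 t x : 0 <= t -> q (t *: x) = t * q x.
  move=> t0; apply/le_anti; rewrite qZ//=.
  (* The reverse inequality is the homogeneity bound at [- x]. *)
  by have := qZ t (- x) t0; rewrite scalerN !qN; lra.
move=> t x z; rewrite qD; congr (_ + _).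
have [t0|/ltW t0] := leP 0 t; first exact: qZ_ge0.
have := qZ_ge0 (- t) x; rewrite oppr_ge0 scaleNr qN mulNr => /(_ t0).
exact: oppr_inj.
Qed.

Theorem hahn_banach_cone (R : realType) (V : lmodType R) (p : V -> R)
    (S : set (V * R)) :
  sublinear p -> convex_cone_below p S ->
  exists f : {linear V -> R^o},
    (forall x, f x <= p x) /\ (forall v r, S (v, r) -> r <= f v).
Proof.
move=> slp coneS.
have [q [slq qle qmin]] :=
  exists_minimal_sublinear (cone_inf_sublinear slp coneS).
have qlin := minimal_sublinear_linear slq qmin.
pose f : {linear V -> R^o} :=
  HB.pack (q : V -> R^o) (GRing.isLinear.Build R V R^o *:%R q qlin).
have fp : forall v r, S (v, r) -> forall x, f x <= p (x + v) - r.
  by move=> v r Svr x; exact: le_trans (qle x) (cone_inf_le x slp coneS Svr).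
have [S0 _ _ _] := coneS.
exists f; split=> [x|v r Svr]; first by have := fp _ _ S0 x; rewrite addr0 subr0.
(* At [x = - v] the bound reads [- f v <= p 0 - r], and [p 0 <= 0]. *)
have := fp _ _ Svr (- v); rewrite linearN addNr.
by have := slp.2 0 0 (lexx _); rewrite scale0r; lra.
Qed.

(** * Norming functionals and approximate orthogonality *)

Lemma norm_sublinear (R : realType) (X : normedModType R) :
  sublinear (fun x : X => `|x|).
Proof. by split=> [x y|t x t0]; rewrite ?ler_normD// normrZ ger0_norm. Qed.

(** The bound at [x] and [- x] gives continuity and norm at most 1; normalising [y] shows that 1 is
    attained. *)
Lemma linear_le_norm_dual_sphere (R : realType) (X : normedModType R)
    (f : {linear X -> R^o}) (y : X) :
  y != 0 -> (forall x, f x <= `|x|) -> f y = `|y| -> dual_sphere f.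
Proof.
move=> y0 fle fy.
have absf x : `|f x| <= `|x|.
  by rewrite ler_norml fle andbT lerNl -linearN -(normrN x) fle.
split.
  apply/linear_bounded_continuous/linear_boundedP.
  apply: filterS (nbhs_pinfty_ge (num_real 1)) => r r1 x.
  by apply: le_trans (absf x) _; exact: ler_peMl.
have ub : ubound [set `|f z| | z in [set z : X | `|z| <= 1]] 1.
  by move=> _ [z /= z1 <-]; exact: le_trans (absf z) z1.
apply/le_anti/andP; split.
  by apply: ge_sup => //; exists `|f 0|, 0; rewrite //= normr0.
apply: ub_le_sup; first by exists 1.
exists (`|y|^-1 *: y).
  by rewrite /= normrZ normfV normr_id mulVf// normr_eq0.
by rewrite linearZ/= fy /GRing.scale/= mulVf ?normr1// normr_eq0.
Qed.

(* Convexity of [t |-> `|x + t y|] lets one shrink [t] until the quadratic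
   term is negligible. *)
Lemma approx_BJ_orth_norm (R : realType) (X : normedModType R)
    (eps : R) (x y : X) (l : R) :
  0 <= eps -> approx_BJ_orth eps x y ->
  `|x| <= `|x + l *: y| + eps * `|l *: y|.
Proof.
move=> eps0 orth; rewrite leNgt; apply/negP => lt_x.
have x0 : 0 < `|x| by apply: le_lt_trans lt_x; rewrite addr_ge0// mulr_ge0.
pose d := `|x + l *: y| - `|x|.
pose k := - (2 * `|x| * (d + eps * `|l *: y|)).
have k0 : 0 < k by rewrite oppr_gt0 pmulr_rlt0 ?mulr_gt0// /d; lra.
have sk0 : 0 < d ^+ 2 + k by rewrite ltr_wpDl// sqr_ge0.
(* Orthogonality will force [0 <= t * d ^+ 2 - k], but this [t] makes the right side equal to
   [- (t * k) < 0]. *)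
pose t := k / (d ^+ 2 + k).
have t0 : 0 < t by rewrite divr_gt0.
have t1 : t <= 1 by rewrite ler_pdivrMr// mul1r lerDr sqr_ge0.
have tE : t * (d ^+ 2 + k) = k by rewrite divfK// gt_eqF.
clearbody t.
have convex : `|x + (t * l) *: y| <= `|x| + t * d.
  have -> : x + (t * l) *: y = (1 - t) *: x + t *: (x + l *: y).
    by rewrite scalerDr scalerA addrA -scalerDl subrK scale1r.
  apply: le_trans (ler_normD _ _) _.
  by rewrite !normrZ ger0_norm ?subr_ge0// gtr0_norm// /d; lra.
have := le_trans (orth (t * l)) (lerXn2r 2 (normr_ge0 _)
  (le_trans (normr_ge0 _) convex) convex).
rewrite -scalerA normrZ gtr0_norm// => quad.
have : 0 <= t * (t * d ^+ 2 - k) by rewrite /k; lra.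
rewrite pmulr_rge0// => ktd.
by have := mulr_gt0 t0 k0; lra.
Qed.

Lemma approx_BJ_orth_functional (R : realType) (X : normedModType R)
    (eps : R) (y z : X) :
  0 <= eps -> y != 0 -> approx_BJ_orth eps y z ->
  exists2 f : {linear X -> R^o}, J y f & `|f z| <= eps * `|z|.
Proof.
move=> eps0 y0 orth.
(* Lying above [S] forces both [f y >= `|y|] (at [b = 0]) and the bound on
   [f z] (at [t = 0], [b = 1] or [-1]). *)
pose S : set (X * R) := [set s | exists t b,
  [/\ 0 <= t, s.1 = t *: y + b *: z & s.2 <= t * `|y| - eps * `|b *: z|]].
have coneS : convex_cone_below (fun x : X => `|x|) S.
  split.
  - by exists 0, 0; split; rewrite ?scale0r ?addr0// normr0 mulr0 mul0r subr0.
  - move=> v r w s [t [b [/= t0 -> rle]]] [u [c [/= u0 -> sle]]].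
    exists (t + u), (b + c); split; rewrite /= ?addr_ge0//.
      by rewrite !scalerDl addrACA.
    (* The [<=] in [S] absorbs the loss in the triangle inequality. *)
    have := ler_wpM2l eps0 (ler_normD (b *: z) (c *: z)).
    by rewrite -scalerDl; lra.
  - move=> t v r t0 [u [b [/= u0 -> rle]]].
    exists (t * u), (t * b); split; rewrite /= ?mulr_ge0//.
      by rewrite scalerDr !scalerA.
    have := ler_wpM2l t0 rle.
    by rewrite -scalerA (normrZ t) (ger0_norm t0); lra.
  - move=> v r [t [b [/= t0 -> /le_trans]]]; apply; rewrite lerBlDr.
    move: t0; rewrite le_eqVlt => /predU1P[<-|t0].
      by rewrite mul0r addr_ge0// mulr_ge0.
    (* For [t > 0], orthogonality at [t^-1 * b] is rescaled by [t]. *)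
    have := ler_wpM2l (ltW t0) (approx_BJ_orth_norm (t^-1 * b) eps0 orth).
    rewrite mulrDr mulrCA -{2 4}(ger0_norm (ltW t0)) -!normrZ.
    by rewrite scalerDr scalerA mulrA mulfV ?gt_eqF// mul1r.
have [f [fle Sf]] := hahn_banach_cone (@norm_sublinear R X) coneS.
have fy : f y = `|y|.
  apply/le_anti; rewrite fle/=; apply: Sf; exists 1, 0.
  by rewrite !scale0r scale1r addr0 normr0 mulr0 mul1r subr0.
exists f; first by split=> //; exact: linear_le_norm_dual_sphere fy.
have fge b : `|b| = 1 -> - (eps * `|z|) <= f (b *: z).
  move=> b1; apply: Sf; exists 0, b.
  by rewrite scale0r add0r mul0r sub0r normrZ b1 mul1r.
rewrite ler_norml; have := fge 1 (normr1 _); have := fge (-1) (normrN1 _).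
by rewrite scaleN1r scale1r linearN/= lerN2 => -> ->.
Qed.

(** * Strong anti-coproximinality *)

Unset Implicit Arguments.
Set Strict Implicit.

Theorem theorem2p13 (R : realType) (X : completeNormedModType R)
    (Y : submodClosed X)
    (Yproper : exists x : X, x \notin Y)
    (Ydim : dim_gt Y 1)
    (hJ : forall x : X, x \notin Y ->
      exists y : X, [/\ y \in Y, y != 0 & J y `<=` J x `|` J (- x)]) :
  strongly_anti_coproximinal Y.
Proof.
move=> x eps xY /andP[eps0 eps1] [y0 [y0Y best]].
(* This makes [hJ] applicable to [x - y0] itself, and also shows that it is nonzero. *)
have zY : x - y0 \notin Y.
  by apply: contra xY => zY; rewrite -(subrK y0 x) rpredD.
have [y [yY yn0 Jy]] := hJ _ zY.
have [f Jf fz] := approx_BJ_orth_functional eps0 yn0 (best _ yY).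
have z0 : 0 < `|x - y0|.
  by rewrite normr_gt0; apply: contra zY => /eqP ->; rewrite rpred0.
have fzE : `|f (x - y0)| = `|x - y0|.
  have [[_ ->]|[_]] := Jy _ Jf; first by rewrite normr_id.
  by rewrite linearN normrN => fN; rewrite -(normrN (f _)) fN normr_id.
by move: fz; rewrite fzE -ler_pdivrMr// divff ?gt_eqF// leNgt eps1.
Qed.
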